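(* Let $\rho_{\mathit{disj}}$ be the uniform distribution on $\{(0,0),(0,1),(1,0)\}\subset\{0,1\}\times\{0,1\}$. Then, as $n\to\infty$, $$\mathrm{col}_{\rho_{\mathit{disj}}}(n)=O\bigl(n^{\log_6 2}\bigr)\quad\text{and}\quad \mathrm{col}_{\rho_{\mathit{disj}}}(n)=\Omega\bigl(n^{1/4}\bigr);$$ in particular $\mathrm{col}_{\rho_{\mathit{disj}}}(n)$ is $O(n^{0.387})$ and $\Omega(n^{0.25})$.
   Context: Collision complexity. For a probability distribution $\rho$ on $U\times V$, a $p$-collision protocol for $\rho$ with domain size $n$ consists of $\ell\in\mathbb{N}$ and maps $A\colon U^\ell\to\mathcal P([n])$, $B\colon V^\ell\to\mathcal P([n])$ (possibly randomised using private independent randomness) such that $\Pr_{(\vec u,\vec v)\sim\rho^{\otimes\ell}}[i\in A(\vec u)\cap B(\vec v)]\ge p$ for every $i\in[n]$. Its output size is the maximum possible value of $\max\{|A(\vec u)|,|B(\vec v)|\}$. $\mathrm{col}_\rho(n,p)$ is the infimum of the output size over all $p$-collision protocols for $\rho$ with domain size $n$, and $\mathrm{col}_\rho(n)=\mathrm{col}_\rho(n,1/n)$. *)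

(* Defs.v *)
From mathcomp Require Import all_boot all_order all_algebra.
From mathcomp Require Import all_classical all_reals all_analysis.

Set Implicit Arguments.
Unset Strict Implicit.
Unset Printing Implicit Defensive.

Import Order.TTheory GRing.Theory Num.Theory.
Import numFieldNormedType.Exports.

Local Open Scope classical_set_scope.
Local Open Scope ring_scope.

Record fdist (R : realType) (T : finType) := FDist {
  fdist_fun :> T -> R;
  fdist_ge0 : forall x, 0 <= fdist_fun x;
  fdist_sum1 : \sum_(x : T) fdist_fun x = 1 }.

Section Dirac.
Context (R : realType) (T : finType) (a : T).

Definition dirac_fun (x : T) : R := (x == a)%:R.

Lemma dirac_ge0 x : 0 <= dirac_fun x. Proof. exact: ler0n. Qed.

Lemma dirac_sum1 : \sum_x dirac_fun x = 1.
Proof.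
by rewrite (bigD1 a)//= big1 ?addr0 /dirac_fun ?eqxx// => x /negPf ->.
Qed.

Definition fdist_dirac := FDist dirac_ge0 dirac_sum1.

End Dirac.

Section Uniform.
Context (R : realType) (T : finType) (A : {set T}) (A0 : A != finset.set0).

Definition uniform_fun (x : T) : R := if x \in A then #|A|%:R^-1 else 0.

Lemma uniform_ge0 x : 0 <= uniform_fun x.
Proof. by rewrite /uniform_fun; case: ifP => // _; rewrite invr_ge0. Qed.

Lemma uniform_sum1 : \sum_x uniform_fun x = 1.
Proof.
rewrite -big_mkcond/= sumr_const -[LHS]mulr_natr mulVf//.
by rewrite pnatr_eq0 cards_eq0.
Qed.

Definition fdist_uniform := FDist uniform_ge0 uniform_sum1.

End Uniform.

(* The law of l independent samples from rho. *)
Section Tensor.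
Context (R : realType) (T : finType) (rho : fdist R T) (l : nat).

Definition tensor_fun (w : {ffun 'I_l -> T}) : R := \prod_(k < l) rho (w k).

Lemma tensor_ge0 w : 0 <= tensor_fun w.
Proof. by apply: prodr_ge0 => k _; exact: fdist_ge0. Qed.

Lemma tensor_sum1 : \sum_w tensor_fun w = 1.
Proof.
rewrite -(bigA_distr_bigA (fun (_ : 'I_l) x => rho x)) big1// => k _.
exact: fdist_sum1.
Qed.

Definition fdist_tensor := FDist tensor_ge0 tensor_sum1.

End Tensor.

(* A map U^l -> P([n]) using private randomness is represented by its Markov
   kernel, i.e. by the law of its output for each input; a deterministic map is
   a kernel of Dirac masses. *)
Record protocol (R : realType) (U V : finType) (n : nat) := Protocol {
  nsamples : nat;
  alice : {ffun 'I_nsamples -> U} -> fdist R {set 'I_n};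
  bob : {ffun 'I_nsamples -> V} -> fdist R {set 'I_n} }.

Section Collision.
Context (R : realType) (U V : finType) (rho : fdist R (U * V)%type).

Section Protocol.
Context (n : nat) (pi : protocol R U V n).

Notation samples := {ffun 'I_(nsamples pi) -> U * V}.
Notation outcome := (samples * {set 'I_n} * {set 'I_n})%type.

(* The joint law of the samples (u_k, v_k)_k and of the outputs A(u) and B(v);
   the two randomisations being private, A(u) and B(v) are independent given
   the samples. *)
Definition joint_law (z : outcome) : R :=
  let: (w, X, Y) := z in
  fdist_tensor rho (nsamples pi) w
  * alice [ffun k => (w k).1] X * bob [ffun k => (w k).2] Y.

Definition collision_prob (i : 'I_n) : R :=
  \sum_(z : outcome | i \in z.1.2 :&: z.2) joint_law z.

Definition is_collision_protocol (p : R) : Prop :=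
  forall i : 'I_n, p <= collision_prob i.

(* Only outcomes of positive probability are possible. *)
Definition output_size : nat :=
  (\max_(z : outcome | (0 < joint_law z)%R) maxn #|z.1.2| #|z.2|)%N.

End Protocol.

(* Extended-real valued: it is +oo when there is no p-collision protocol,
   i.e. when 1 < p and 0 < n. *)
Definition ext_collision_complexity (n : nat) (p : R) : \bar R :=
  ereal_inf [set (output_size pi)%:R%:E
            | pi in [set pi : protocol R U V n | is_collision_protocol pi p]].

(* By ext_collision_complexity_fin_num below, the argument of fine is always
   finite (for n = 0, n%:R^-1 is 0). *)
Definition collision_complexity (n : nat) : R :=
  fine (ext_collision_complexity n n%:R^-1).

(* The protocol that outputs [n] without sampling succeeds surely. *)
Lemma ext_collision_complexity_fin_num (n : nat) (p : R) :
  p <= 1 -> ext_collision_complexity n p \is a fin_num.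
Proof.
move=> p1; pose pi := @Protocol R U V n 0
  (fun=> fdist_dirac R (finset.setTfor _))
  (fun=> fdist_dirac R (finset.setTfor _)).
have piP : is_collision_protocol pi p.
  move=> i; apply: le_trans p1 _.
  pose z0 : {ffun 'I_0 -> U * V} * {set 'I_n} * {set 'I_n} :=
    ([ffun k : 'I_0 => False_rect _ (ltac:(by case: k))],
     finset.setTfor _, finset.setTfor _).
  rewrite /collision_prob (bigD1 z0) /= ?inE//.
  rewrite /tensor_fun big_ord0 /dirac_fun !eqxx !mulr1 lerDl.
  apply: sumr_ge0 => -[[w X] Y] _ /=.
  by rewrite !mulr_ge0 ?tensor_ge0 ?dirac_ge0.
rewrite fin_numElt; apply/andP; split.
  apply: (@lt_le_trans _ _ 0%E); first exact: ltNy0.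
  by apply: le_ereal_inf_tmp => _ [sg _ <-]; rewrite lee_fin.
apply: (@le_lt_trans _ _ (output_size pi)%:R%:E); last exact: ltry.
by apply: ereal_inf_lbound; exists pi.
Qed.

End Collision.

Definition disj_supp : {set bool * bool} :=
  [set (false, false); (false, true); (true, false)]%SET.

Lemma disj_supp_neq0 : disj_supp != finset.set0.
Proof. by apply/set0Pn; exists (false, false); rewrite !inE. Qed.

Definition rho_disj (R : realType) : fdist R (bool * bool)%type :=
  fdist_uniform R disj_supp_neq0.

Definition log_base (R : realType) (b x : R) : R := ln x / ln b.

(* Main.v *)
Require Import Defs.
From mathcomp Require Import all_boot all_order all_algebra.
From mathcomp Require Import all_classical all_reals all_analysis.
From mathcomp Require Import ring lra zify.
Import Order.TTheory GRing.Theory Num.Theory.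
Import numFieldNormedType.Exports.
Local Open Scope classical_set_scope.
Local Open Scope ring_scope.

(** Lower bound: one sample of rho_disj satisfies the two-function
    hypercontractive inequality E[f(u) g(v)] <= |f|_(3/2) |g|_(3/2), with
    norms taken over the marginals, and this tensorizes.  For the
    probabilities f_i(u) and g_i(v) that i is in A(u) and in B(v) it gives
    n^-3 <= (E f_i * E g_i)^2 <= ((E f_i + E g_i) / 2)^4; summing the resulting
    bound n^(-3/4) <= (E f_i + E g_i) / 2 over i bounds the output size from
    below by n^(1/4).

    Upper bound: with probability 3^-l the l samples are exactly (b_k, ~~ b_k)
    for a prescribed b, so assigning to every string b a block of about n / 2^l
    elements of [n] gives a collision protocol as soon as 3^l <= n.  Its output
    size is O(n^(1 - log_3 2)), and 1 - log_3 2 = 0.369... < log_6 2. *)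

Set Implicit Arguments.
Unset Strict Implicit.

(** * Hypercontractivity for a single sample *)

(** Hoelder with exponents 3 and 3/2 on two points of weights 2 and 1, cubed. The defect is a
    nonnegative combination of multiples of (h d - k c)^2, which vanishes in the proportional
    case. *)
Lemma holder_two_points (R : realDomainType) (h k c d : R) :
  0 <= h -> 0 <= k -> 0 <= c -> 0 <= d ->
  (2 * h * c ^+ 2 + k * d ^+ 2) ^+ 3
  <= (2 * h ^+ 3 + k ^+ 3) * (2 * c ^+ 3 + d ^+ 3) ^+ 2.
Proof.
move=> h0 k0 c0 d0; rewrite -subr_ge0.
have -> : (2 * h ^+ 3 + k ^+ 3) * (2 * c ^+ 3 + d ^+ 3) ^+ 2
    - (2 * h * c ^+ 2 + k * d ^+ 2) ^+ 3
  = 4 * c ^+ 3 * ((h * d - k * c) ^+ 2 * (2 * (h * d) + k * c))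
    + 2 * d ^+ 3 * ((h * d - k * c) ^+ 2 * (h * d + 2 * (k * c))) by ring.
by rewrite !(sqr_ge0, mulr_ge0, addr_ge0, exprn_ge0) //.
Qed.

(* Hoelder in (c, d) leaves an inequality in (x, y) whose defect is
   (x - y)^4 (x^2 + 4 x y + y^2) / 4. *)
Lemma disj_hypercontractive (R : realFieldType) (x y c d : R) :
  0 <= x -> 0 <= y -> 0 <= c -> 0 <= d ->
  3 * (x ^+ 2 * c ^+ 2 + x ^+ 2 * d ^+ 2 + y ^+ 2 * c ^+ 2) ^+ 3
  <= (2 * x ^+ 3 + y ^+ 3) ^+ 2 * (2 * c ^+ 3 + d ^+ 3) ^+ 2.
Proof.
move=> x0 y0 c0 d0.
(* With x, y the values of f and c, d those of g at [false], [true], these two numbers are the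
   conditional means of f^2 given v = [false] and v = [true]. *)
have := @holder_two_points R ((x ^+ 2 + y ^+ 2) / 2) (x ^+ 2) c d.
rewrite divr_ge0 ?addr_ge0 ?sqr_ge0 // => /(_ isT isT c0 d0) H.
have {}H : (x ^+ 2 * c ^+ 2 + x ^+ 2 * d ^+ 2 + y ^+ 2 * c ^+ 2) ^+ 3 <=
   (2 * ((x ^+ 2 + y ^+ 2) / 2) ^+ 3 + x ^+ 2 ^+ 3) * (2 * c ^+ 3 + d ^+ 3) ^+ 2.
  by apply: le_trans H; rewrite le_eqVlt; apply/orP; left; apply/eqP; field.
apply: le_trans (_ : 3 * ((2 * ((x ^+ 2 + y ^+ 2) / 2) ^+ 3 + x ^+ 2 ^+ 3)
                          * (2 * c ^+ 3 + d ^+ 3) ^+ 2) <= _).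
  by rewrite ler_pM2l.
rewrite mulrA ler_wpM2r ?sqr_ge0 // -subr_ge0.
have -> : (2 * x ^+ 3 + y ^+ 3) ^+ 2
  - 3 * (2 * ((x ^+ 2 + y ^+ 2) / 2) ^+ 3 + x ^+ 2 ^+ 3)
  = ((x - y) ^+ 2) ^+ 2 * (x ^+ 2 + 4 * (x * y) + y ^+ 2) / 4 by field.
by rewrite divr_ge0 // !(sqr_ge0, mulr_ge0, addr_ge0) //.
Qed.

(** * Tensorization by splitting off the first coordinate *)

Definition ffun_cons {T : Type} {l} (x : T) (w : {ffun 'I_l -> T}) :
    {ffun 'I_l.+1 -> T} :=
  [ffun i => oapp w x (unlift ord0 i)].

Lemma ffun_cons0 (T : Type) l (x : T) (w : {ffun 'I_l -> T}) :
  ffun_cons x w ord0 = x.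
Proof. by rewrite ffunE unlift_none. Qed.

Lemma ffun_consS (T : Type) l (x : T) (w : {ffun 'I_l -> T}) i :
  ffun_cons x w (lift ord0 i) = w i.
Proof. by rewrite ffunE liftK. Qed.

Lemma ffun_comp_cons (T T' : Type) (f : T -> T') l (x : T) (w : {ffun 'I_l -> T}) :
  [ffun k => f (ffun_cons x w k)] = ffun_cons (f x) [ffun k => f (w k)].
Proof.
by apply/ffunP => k; rewrite !ffunE; case: unliftP => //= j _; rewrite ffunE.
Qed.

Lemma big_ffun_cons (R : nmodType) (T : finType) l (F : {ffun 'I_l.+1 -> T} -> R) :
  \sum_w F w = \sum_(x : T) \sum_(w : {ffun 'I_l -> T}) F (ffun_cons x w).
Proof.
rewrite pair_big_dep /=.
rewrite (reindex (fun p : T * {ffun 'I_l -> T} => ffun_cons p.1 p.2)) //=.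
exists (fun w => (w ord0, [ffun i => w (lift ord0 i)])) => [[x w]|w] _ /=.
  rewrite ffun_cons0; congr (_, _).
  by apply/ffunP => i; rewrite ffunE ffun_consS.
apply/ffunP => i; case: (unliftP ord0 i) => [j ->|->].
  by rewrite ffun_consS ffunE.
by rewrite ffun_cons0.
Qed.

(* Cube roots of the conditional third moments given the first coordinate
   reduce the induction step to the case of one coordinate. *)
Lemma hypercontractive_tensor (R : realType) (U V : finType)
    (rho : U * V -> R) (mu : U -> R) (nu : V -> R) :
  (forall z, 0 <= rho z) -> (forall u, 0 <= mu u) -> (forall v, 0 <= nu v) ->
  (forall (f : U -> R) (g : V -> R),
    (forall u, 0 <= f u) -> (forall v, 0 <= g v) ->
    (\sum_z rho z * (f z.1 ^+ 2 * g z.2 ^+ 2)) ^+ 3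
    <= (\sum_u mu u * f u ^+ 3) ^+ 2 * (\sum_v nu v * g v ^+ 3) ^+ 2) ->
  forall l (f : {ffun 'I_l -> U} -> R) (g : {ffun 'I_l -> V} -> R),
    (forall u, 0 <= f u) -> (forall v, 0 <= g v) ->
    (\sum_(w : {ffun 'I_l -> U * V}) (\prod_k rho (w k))
       * (f [ffun k => (w k).1] ^+ 2 * g [ffun k => (w k).2] ^+ 2)) ^+ 3
    <= (\sum_(u : {ffun 'I_l -> U}) (\prod_k mu (u k)) * f u ^+ 3) ^+ 2
       * (\sum_(v : {ffun 'I_l -> V}) (\prod_k nu (v k)) * g v ^+ 3) ^+ 2.
Proof.
move=> rho0 mu0 nu0 H; elim=> [|l IH] f g f0 g0.
  have one (T : finType) (F : {ffun 'I_0 -> T} -> R) (h : {ffun 'I_0 -> T}) :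
      \sum_w F w = F h.
    rewrite (bigD1 h) //= big1 ?addr0 // => w /eqP[].
    by apply/ffunP; case.
  have e T : {ffun 'I_0 -> T} by apply: finfun; case.
  rewrite !(one _ _ (e _)) !big_ord0 !mul1r.
  set x := f _; set y := g _.
  have -> : f (e U) = x by congr f; apply/ffunP; case.
  have -> : g (e V) = y by congr g; apply/ffunP; case.
  by rewrite exprMn -!exprM.
pose cbrt (x : R) := x `^ 3^-1.
have cbrt0 x : 0 <= cbrt x by exact: powR_ge0.
have cbrtK x : 0 <= x -> cbrt x ^+ 3 = x.
  by move=> x0; rewrite -powR_mulrn ?powR_ge0 // -powRrM mulVf ?pnatr_eq0 // powRr1.
pose f' u := cbrt
  (\sum_(u' : {ffun 'I_l -> U}) (\prod_k mu (u' k)) * f (ffun_cons u u') ^+ 3).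
pose g' v := cbrt
  (\sum_(v' : {ffun 'I_l -> V}) (\prod_k nu (v' k)) * g (ffun_cons v v') ^+ 3).
have f'3 u : f' u ^+ 3 =
    \sum_(u' : {ffun 'I_l -> U}) (\prod_k mu (u' k)) * f (ffun_cons u u') ^+ 3.
  by rewrite cbrtK // sumr_ge0 // => u' _; rewrite mulr_ge0 ?exprn_ge0 ?prodr_ge0.
have g'3 v : g' v ^+ 3 =
    \sum_(v' : {ffun 'I_l -> V}) (\prod_k nu (v' k)) * g (ffun_cons v v') ^+ 3.
  by rewrite cbrtK // sumr_ge0 // => v' _; rewrite mulr_ge0 ?exprn_ge0 ?prodr_ge0.
have consE (T : finType) (m : T -> R) (h : {ffun 'I_l.+1 -> T} -> R) :
    \sum_(w : {ffun 'I_l.+1 -> T}) (\prod_k m (w k)) * h w =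
    \sum_x m x * \sum_(w : {ffun 'I_l -> T}) (\prod_k m (w k)) * h (ffun_cons x w).
  rewrite big_ffun_cons; apply: eq_bigr => x _.
  rewrite big_distrr /=; apply: eq_bigr => w _.
  rewrite big_ord_recl ffun_cons0 mulrA; congr (_ * _ * _).
  by apply: eq_bigr => k _; rewrite ffun_consS.
rewrite !consE.
under [X in _ <= X ^+ 2 * _]eq_bigr do rewrite -f'3.
under [X in _ <= _ * X ^+ 2]eq_bigr do rewrite -g'3.
apply: le_trans (H f' g' (fun=> cbrt0 _) (fun=> cbrt0 _)).
have nn (x : U * V) (w : {ffun 'I_l -> U * V}) : 0 <= \prod_k rho (w k) *
     (f [ffun k => (ffun_cons x w k).1] ^+ 2 *
      g [ffun k => (ffun_cons x w k).2] ^+ 2).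
  by rewrite mulr_ge0 ?prodr_ge0 // mulr_ge0 ?sqr_ge0.
have rhs0 : 0 <= \sum_z rho z * (f' z.1 ^+ 2 * g' z.2 ^+ 2).
  by apply: sumr_ge0 => z _; do 2! apply: mulr_ge0 => //; exact: sqr_ge0.
rewrite lerXn2r ?nnegrE // ?sumr_ge0 // => [z _|].
  by rewrite mulr_ge0 ?sumr_ge0.
(* For a fixed first sample (a, b), the cubed inequality is the induction hypothesis for the
   sections of f at a and of g at b. *)
apply: ler_sum => -[a b] _ /=; rewrite ler_wpM2l //.
rewrite -(@ler_pXn2r _ 3) ?nnegrE ?sumr_ge0 ?(mulr_ge0 (sqr_ge0 _) (sqr_ge0 _)) //.
have -> : (f' a ^+ 2 * g' b ^+ 2) ^+ 3 = (f' a ^+ 3) ^+ 2 * (g' b ^+ 3) ^+ 2 by ring.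
rewrite f'3 g'3.
apply: le_trans (IH (fun u => f (ffun_cons a u)) (fun v => g (ffun_cons b v)) _ _) => //.
by under eq_bigr do rewrite !ffun_comp_cons.
Qed.

(** * From the infimum to individual protocols *)

Lemma rho_disjE (R : realType) (z : bool * bool) :
  rho_disj R z = if z.1 && z.2 then 0 else 3^-1.
Proof.
have card3 : #|disj_supp| = 3%N.
  by rewrite /disj_supp !cardsU !cards1 !finset.setIUl !cardsU -!finset.setIA;
     do ?[rewrite (_ : _ :&: _ = finset.set0)%SET;
           last by apply/setP => -[[] []]; rewrite !inE];
     rewrite ?cards0.
by rewrite /= /Defs.uniform_fun card3; case: z => -[] []; rewrite !inE.
Qed.

Lemma le_collision_complexity (R : realType) (U V : finType)
    (rho : fdist R (U * V)%type) (n : nat) (x : R) :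
  (forall pr : protocol R U V n, is_collision_protocol rho pr n%:R^-1 ->
     x <= (output_size rho pr)%:R) ->
  x <= collision_complexity rho n.
Proof.
move=> H; rewrite -lee_fin fineK.
  by apply: le_ereal_inf_tmp => _ [pr Hpi <-]; rewrite lee_fin; apply: H.
apply: ext_collision_complexity_fin_num.
(* At n = 0 the inverse defaults to 0, so the required probability is still at most 1. *)
by case: n {H} => [|n]; rewrite ?invr0 // invf_le1 // ler1n.
Qed.

Lemma collision_complexity_le (R : realType) (U V : finType)
    (rho : fdist R (U * V)%type) (n : nat) (pr : protocol R U V n) :
  is_collision_protocol rho pr n%:R^-1 ->
  collision_complexity rho n <= (output_size rho pr)%:R.
Proof.
move=> H; rewrite -lee_fin fineK.
  by apply: ereal_inf_lbound; exists pr.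
apply: ext_collision_complexity_fin_num.
by case: n {pr H} => [|n]; rewrite ?invr0 // invf_le1 // ler1n.
Qed.

(** * Upper bound: the antipodal protocol *)

(** Cut the domain into consecutive blocks of length m, one per element of [T]; within a block, the
    residue modulo m is injective. *)
Lemma exists_bounded_fibres (T : finType) (n m : nat) :
  (n <= #|T| * m)%N ->
  exists h : 'I_n -> T, forall t, (#|[set i | h i == t]%SET| <= m)%N.
Proof.
case: m => [|m] nTm.
  have n0 : n = 0%N by lia.
  subst n; exists (fun i : 'I_0 => False_rect T (ltac:(by case: i))) => t.
  by rewrite (leq_trans (max_card _)) // card_ord.
have lt_block (i : 'I_n) : (i %/ m.+1 < #|T|)%N.
  by rewrite ltn_divLR // (leq_trans (ltn_ord i)).
exists (fun i => enum_val (Ordinal (lt_block i))) => t.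
rewrite -[X in (_ <= X)%N]card_ord 
  -(card_in_imset (f := fun i : 'I_n => inord (i %% m.+1) : 'I_m.+1)).
  exact: max_card.
move=> i j; rewrite !inE => /eqP <- /eqP /enum_val_inj /(congr1 val) /= qE.
move=> /(congr1 val); rewrite /= !inordK ?ltn_pmod // => rE.
by apply/val_inj; rewrite /= (divn_eq i m.+1) (divn_eq j m.+1) qE rE.
Qed.

(* Alice guesses that the samples are exactly [(b_k, ~~ b_k)] with [b = u], Bob
   that they are so with [b = ~~ v]; both are right with probability 3^-l for
   each of the 2^l strings [b], and each string stands for at most [m] elements
   of the domain. *)
Definition antipodal_protocol (R : realType) (n l : nat)
    (h : 'I_n -> {ffun 'I_l -> bool}) : protocol R bool bool n :=
  Protocol (fun u => fdist_dirac R [set i | h i == u]%SET)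
           (fun v : {ffun 'I_l -> bool} =>
              fdist_dirac R [set i | h i == [ffun k => ~~ v k]]%SET).

Lemma antipodal_protocolP (R : realType) (n l : nat)
    (h : 'I_n -> {ffun 'I_l -> bool}) :
  is_collision_protocol (rho_disj R) (antipodal_protocol R h) (3 ^- l).
Proof.
move=> i.
pose S := [set j | h j == h i]%SET.
(* This outcome alone has probability 3^-l: every sample lies in the support, and both players
   output the fibre of [h i]. The other outcomes contribute nonnegative terms. *)
pose z : {ffun 'I_l -> bool * bool} * {set 'I_n} * {set 'I_n} :=
  ([ffun k => (h i k, ~~ h i k)], S, S).
rewrite /collision_prob (bigD1 z) /=; last by rewrite !inE eqxx.
rewrite [X in X * _ * _](_ : _ = 3 ^- l); last first.
  rewrite /tensor_fun -exprVn -[in RHS](card_ord l) -prodr_const.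
  by apply: eq_bigr => k _; rewrite ffunE rho_disjE /= andbN.
have hA : [ffun k => ([ffun k => (h i k, ~~ h i k)] k).1] = h i.
  by apply/ffunP => k; rewrite !ffunE.
have hB : [ffun k => ~~ ([ffun k => ([ffun k => (h i k, ~~ h i k)] k).2] k)] = h i.
  by apply/ffunP => k; rewrite !ffunE /= negbK.
rewrite /dirac_fun hA hB !eqxx !mulr1 lerDl.
apply: sumr_ge0 => -[[w X] Y] _.
by rewrite !mulr_ge0 ?fdist_ge0 ?(fdist_ge0 (fdist_tensor _ _)) ?dirac_ge0.
Qed.

Lemma antipodal_protocol_size (R : realType) (n l m : nat)
    (h : 'I_n -> {ffun 'I_l -> bool}) :
  (forall b, (#|[set i | h i == b]%SET| <= m)%N) ->
  (output_size (rho_disj R) (antipodal_protocol R h) <= m)%N.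
Proof.
move=> hm; apply/bigmax_leqP => -[[w X] Y] /=; rewrite /dirac_fun.
have [->|_] := eqVneq X; last by rewrite mulr0 mul0r ltxx.
have [-> _|_] := eqVneq Y; last by rewrite mulr0 ltxx.
by rewrite geq_max !hm.
Qed.

(** The condition on [a] amounts to a >= 1 - log_3 2. Of the constant 3, a summand 2 comes from n /
    2^l and a summand 1 from rounding up the block size. *)
Lemma collision_complexity_le_powR (R : realType) (a : R) (n : nat) :
  0 <= a <= 1 -> 3 `^ (1 - a) <= 2 -> (0 < n)%N ->
  collision_complexity (rho_disj R) n <= 3 * n%:R `^ a.
Proof.
move=> /andP[a0 a1] a3 n0.
(* [l] is the largest number of samples for which 3^-l is still at least 1/n. *)
pose l := trunc_log 3 n; pose m := (n %/ 2 ^ l).+1.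
have lo : (3 ^ l <= n)%N by rewrite trunc_logP.
have hi : (n < 3 ^ l.+1)%N by rewrite trunc_log_ltn.
have [|h hm] := @exists_bounded_fibres {ffun 'I_l -> bool} n m.
  by rewrite card_ffun card_bool card_ord mulnC ltnW // ltn_ceil // expn_gt0.
apply: (@le_trans _ _ m%:R).
  apply: (le_trans (@collision_complexity_le _ _ _ _ _ (antipodal_protocol R h) _)).
    move=> i; apply: le_trans (antipodal_protocolP R h i).
    by rewrite lef_pV2 ?posrE ?ltr0n ?exprn_gt0 // -natrX ler_nat.
  by rewrite ler_nat antipodal_protocol_size.
have n1 : 1 <= n%:R `^ a :> R.
  by rewrite -[leLHS](powRr0 n%:R) ler_powR ?ler1n.
suff H : n%:R <= 2 ^+ l * (2 * n%:R `^ a) :> R.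
  rewrite /m -natr1 -[X in _ <= X%:R * _]/(2.+1) -natr1 mulrDl mul1r lerD //.
  apply: (@le_trans _ _ (n%:R / 2 ^+ l)).
    by rewrite ler_pdivlMr ?exprn_gt0 // -natrX -natrM ler_nat leq_trunc_div.
  by rewrite ler_pdivrMr ?exprn_gt0 // mulrC.
(* The first factor is at most (3^(l+1))^(1-a) = (3^(1-a))^(l+1) <= 2^(l+1). *)
have nE : n%:R = n%:R `^ (1 - a) * n%:R `^ a :> R.
  by rewrite -powRD ?subrK ?powRr1 // pnatr_eq0 -lt0n n0 implybT.
rewrite [leLHS]nE mulrA ler_wpM2r ?powR_ge0 // -exprSr.
apply: (@le_trans _ _ ((3 ^+ l.+1) `^ (1 - a))).
  by rewrite ge0_ler_powR ?nnegrE ?subr_ge0 ?exprn_ge0 // -natrX ler_nat ltnW.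
by rewrite -powR_mulrn // -powRrM mulrC powRrM powR_mulrn ?powR_ge0 //
  lerXn2r ?nnegrE ?powR_ge0.
Qed.

(* 3^5 <= 2^8 *)
Lemma ln3_le (R : realType) : 5 * ln 3 <= 8 * ln 2 :> R.
Proof.
have h k (x : R) : 0 < x -> k%:R * ln x = ln (x ^+ k).
  by move=> x0; rewrite lnXn // mulr_natl.
by rewrite !h // ler_ln ?posrE ?exprn_gt0 // -!natrX ler_nat.
Qed.

Lemma three_powR_le2 (R : realType) (b : R) :
  b * ln 3 <= ln 2 -> 3 `^ b <= 2.
Proof.
by move=> H; rewrite -ler_ln ?posrE ?powR_gt0 // ln_powR.
Qed.

Lemma bigO_collision_complexity (R : realType) (a : R) :
  0 <= a <= 1 -> 3 `^ (1 - a) <= 2 ->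
  (fun n : nat => collision_complexity (rho_disj R) n)
    =O_\oo (fun n : nat => (n%:R : R) `^ a).
Proof.
move=> a01 a3; apply/eqO_exP; exists 3 => //.
near=> n.
have n0 : (0 < n)%N by near: n; exact: nbhs_infty_gt.
rewrite (ger0_norm (powR_ge0 _ _)) ger0_norm ?collision_complexity_le_powR //.
by apply: le_collision_complexity.
Unshelve. all: by end_near. Qed.

(** * Lower bound: hitting probabilities and output size *)

Lemma fdist_gt0 (R : realType) (T : finType) (d : fdist R T) :
  exists x, 0 < d x.
Proof.
apply/existsP; apply: contraT; rewrite negb_exists => /forallP d0.
suff : \sum_x d x = 0 by rewrite fdist_sum1 => /eqP; rewrite oner_eq0.
apply: big1 => x _; apply/eqP; rewrite eq_le fdist_ge0 andbT.
by rewrite leNgt d0.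
Qed.

Definition hit_prob (R : realType) (T : finType) (n : nat)
    (K : T -> fdist R {set 'I_n}) (i : 'I_n) (t : T) : R :=
  \sum_(X : {set 'I_n} | i \in X) K t X.

Lemma hit_prob_ge0 (R : realType) (T : finType) (n : nat)
    (K : T -> fdist R {set 'I_n}) i t : 0 <= hit_prob K i t.
Proof. by apply: sumr_ge0 => X _; apply: fdist_ge0. Qed.

Lemma hit_prob_le1 (R : realType) (T : finType) (n : nat)
    (K : T -> fdist R {set 'I_n}) i t : hit_prob K i t <= 1.
Proof.
rewrite -(fdist_sum1 (K t)) [leRHS](bigID (fun X : {set 'I_n} => i \in X)) /=.
by rewrite lerDl sumr_ge0 // => X _; apply: fdist_ge0.
Qed.

(** Double counting: summed over i, the hitting probabilities give the expected size of the
    output. *)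
Lemma sum_hit_prob_le (R : realType) (T : finType) (n s : nat)
    (K : T -> fdist R {set 'I_n}) (d : fdist R T) :
  (forall t X, 0 < K t X -> (#|X| <= s)%N) ->
  \sum_i \sum_t d t * hit_prob K i t <= s%:R.
Proof.
move=> Ks; rewrite exchange_big /= (_ : s%:R = \sum_t d t * s%:R); last first.
  by rewrite -mulr_suml fdist_sum1 mul1r.
apply: ler_sum => t _; rewrite -mulr_sumr ler_wpM2l ?fdist_ge0 //.
rewrite /hit_prob (exchange_big_dep predT) //=
  (_ : s%:R = \sum_X K t X * s%:R); last first.
  by rewrite -mulr_suml fdist_sum1 mul1r.
apply: ler_sum => X _; rewrite sumr_const -[leLHS]mulr_natr.
have := fdist_ge0 (K t) X; rewrite le_eqVlt => /predU1P[<-|KX].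
  by rewrite !mul0r.
by rewrite ler_pM2l // ler_nat; exact: (Ks t).
Qed.

(** Private randomness makes the two outputs independent given the samples, so the sum over them
    factorizes. *)
Lemma collision_probE (R : realType) (U V : finType)
    (rho : fdist R (U * V)%type) (n : nat) (pr : protocol R U V n) (i : 'I_n) :
  collision_prob rho pr i =
  \sum_(w : {ffun 'I_(nsamples pr) -> U * V}) (\prod_k rho (w k)) *
    (hit_prob (alice (p := pr)) i [ffun k => (w k).1] *
     hit_prob (bob (p := pr)) i [ffun k => (w k).2]).
Proof.
transitivity (\sum_(w : {ffun 'I_(nsamples pr) -> U * V}) \sum_(X : {set 'I_n} | i \in X)
   \sum_(Y : {set 'I_n} | i \in Y) joint_law rho (w, X, Y)).
  rewrite pair_big_dep pair_big_dep; apply: eq_big => [[[w X] Y]|[[w X] Y]] //=.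
  by rewrite inE.
apply: eq_bigr => w _; rewrite big_distrlr /= big_distrr /=.
apply: eq_bigr => X _; rewrite big_distrr /=.
by apply: eq_bigr => Y _; rewrite mulrA.
Qed.

Definition disj_marginal_fun (R : realType) (b : bool) : R := if b then 3^-1 else 2 / 3.

Lemma disj_marginal_ge0 (R : realType) b : 0 <= disj_marginal_fun R b.
Proof. by case: b; rewrite /= ?divr_ge0 ?invr_ge0. Qed.

Lemma disj_marginal_sum1 (R : realType) : \sum_b disj_marginal_fun R b = 1.
Proof. by rewrite big_bool /=; field. Qed.

Definition disj_marginal (R : realType) : fdist R bool :=
  FDist (disj_marginal_ge0 R) (disj_marginal_sum1 R).

(** Hypercontractivity is applied to the square roots of f and g. Their third moments are E f^(3/2)
    <= E f and E g^(3/2) <= E g, as f and g are at most 1. *)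
Lemma disj_tensor_hypercontractive (R : realType) l
    (f g : {ffun 'I_l -> bool} -> R) :
  (forall u, 0 <= f u <= 1) -> (forall v, 0 <= g v <= 1) ->
  (\sum_(w : {ffun 'I_l -> bool * bool}) (\prod_k rho_disj R (w k))
       * (f [ffun k => (w k).1] * g [ffun k => (w k).2])) ^+ 3
  <= (\sum_u fdist_tensor (disj_marginal R) l u * f u) ^+ 2
     * (\sum_v fdist_tensor (disj_marginal R) l v * g v) ^+ 2.
Proof.
move=> f01 g01.
have f0 u : 0 <= f u by case/andP: (f01 u).
have g0 u : 0 <= g u by case/andP: (g01 u).
have base (x y : bool -> R) : (forall u, 0 <= x u) -> (forall u, 0 <= y u) ->
    (\sum_z rho_disj R z * (x z.1 ^+ 2 * y z.2 ^+ 2)) ^+ 3 <=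
    (\sum_u disj_marginal R u * x u ^+ 3) ^+ 2 *
    (\sum_v disj_marginal R v * y v ^+ 3) ^+ 2.
  move=> x0 y0.
  have H := disj_hypercontractive (x0 false) (x0 true) (y0 false) (y0 true).
  have -> : \sum_z rho_disj R z * (x z.1 ^+ 2 * y z.2 ^+ 2) =
      (x false ^+ 2 * y false ^+ 2 + x false ^+ 2 * y true ^+ 2
       + x true ^+ 2 * y false ^+ 2) / 3.
    under eq_bigr => z _ do rewrite rho_disjE.
    rewrite -(pair_bigA _ (fun a b =>
      (if a && b then 0 else 3^-1) * (x a ^+ 2 * y b ^+ 2))) /=.
    by rewrite !big_bool /=; field.
  rewrite !big_bool /=.
  have e (c d : R) : 3^-1 * d ^+ 3 + 2 / 3 * c ^+ 3 = (2 * c ^+ 3 + d ^+ 3) / 3 by field.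
  (* The denominators 3^3 on the left and 3^4 on the right leave the factor 3 of
     [disj_hypercontractive]. *)
  rewrite /disj_marginal_fun !e !expr_div_n mulf_div ler_pdivlMr ?mulr_gt0 ?exprn_gt0 //.
  by apply: le_trans H; rewrite le_eqVlt; apply/orP; left; apply/eqP; field.
have := hypercontractive_tensor
  (fdist_ge0 (rho_disj R)) (fdist_ge0 (disj_marginal R))
  (fdist_ge0 (disj_marginal R)) base
  (f := fun u => Num.sqrt (f u)) (g := fun v => Num.sqrt (g v))
  (fun=> sqrtr_ge0 _) (fun=> sqrtr_ge0 _).
under eq_bigr do rewrite !sqr_sqrtr //.
move=> H; apply: le_trans H _.
have cube_le (h : {ffun 'I_l -> bool} -> R) : (forall u, 0 <= h u <= 1) ->
    0 <= \sum_u fdist_tensor (disj_marginal R) l u * Num.sqrt (h u) ^+ 3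
      <= \sum_u fdist_tensor (disj_marginal R) l u * h u.
  move=> h01; apply/andP; split.
    apply: sumr_ge0 => u _; apply: mulr_ge0; first exact: fdist_ge0.
    by rewrite exprn_ge0 // sqrtr_ge0.
  apply: ler_sum => u _; apply: ler_wpM2l; first exact: fdist_ge0.
  case/andP: (h01 u) => h0 h1.
  by rewrite exprS sqr_sqrtr // ler_piMl // -sqrtr1 ler_wsqrtr.
case/andP: (cube_le f f01) => F0 F1; case/andP: (cube_le g g01) => G0 G1.
apply: ler_pM; rewrite ?sqr_ge0 //.
  by rewrite lerXn2r ?nnegrE ?(le_trans F0 F1).
by rewrite lerXn2r ?nnegrE ?(le_trans G0 G1).
Qed.

Lemma fdist_tensor_disj_gt0 (R : realType) l (w : {ffun 'I_l -> bool * bool}) :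
  (forall k, ~~ ((w k).1 && (w k).2)) -> 0 < fdist_tensor (rho_disj R) l w.
Proof.
by move=> w0; apply: prodr_gt0 => k _; rewrite rho_disjE (negPf (w0 k)) invr_gt0.
Qed.

Lemma output_size_ge (R : realType) (U V : finType)
    (rho : fdist R (U * V)%type) (n : nat) (pr : protocol R U V n)
    (w : {ffun 'I_(nsamples pr) -> U * V}) (X Y : {set 'I_n}) :
  0 < fdist_tensor rho _ w -> 0 < alice (p := pr) [ffun k => (w k).1] X ->
  0 < bob (p := pr) [ffun k => (w k).2] Y ->
  (maxn #|X| #|Y| <= output_size rho pr)%N.
Proof.
move=> w0 X0 Y0.
apply: (@leq_bigmax_cond _ (fun z => 0 < joint_law rho z)
  (fun z : {ffun 'I_(nsamples pr) -> U * V} * {set 'I_n} * {set 'I_n} =>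
     maxn #|z.1.2| #|z.2|) (w, X, Y)).
by rewrite /joint_law !mulr_gt0.
Qed.

(** Every input u of Alice can occur together with the all-[false] input of Bob, so any possible
    output on u belongs to an outcome counted by [output_size]. *)
Lemma alice_card_le (R : realType) (n : nat) (pr : protocol R bool bool n) u X :
  0 < alice (p := pr) u X -> (#|X| <= output_size (rho_disj R) pr)%N.
Proof.
move=> uX; have [Y vY] := fdist_gt0 (bob (p := pr) [ffun=> false]).
have := @output_size_ge _ _ _ (rho_disj R) n pr [ffun k => (u k, false)] X Y.
rewrite geq_max.
rewrite (_ : [ffun k => ([ffun k => (u k, false)] k).1] = u); last first.
  by apply/ffunP => k; rewrite !ffunE.
rewrite (_ : [ffun k => ([ffun k => (u k, false)] k).2] = [ffun=> false]); last first.
  by apply/ffunP => k; rewrite !ffunE.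
by case/(_ _ uX vY)/andP => //; apply: fdist_tensor_disj_gt0 => k; rewrite ffunE andbF.
Qed.

Lemma bob_card_le (R : realType) (n : nat) (pr : protocol R bool bool n) v Y :
  0 < bob (p := pr) v Y -> (#|Y| <= output_size (rho_disj R) pr)%N.
Proof.
move=> vY; have [X uX] := fdist_gt0 (alice (p := pr) [ffun=> false]).
have := @output_size_ge _ _ _ (rho_disj R) n pr [ffun k => (false, v k)] X Y.
rewrite geq_max.
rewrite (_ : [ffun k => ([ffun k => (false, v k)] k).2] = v); last first.
  by apply/ffunP => k; rewrite !ffunE.
rewrite (_ : [ffun k => ([ffun k => (false, v k)] k).1] = [ffun=> false]); last first.
  by apply/ffunP => k; rewrite !ffunE.
by case/(_ _ uX vY)/andP => //; apply: fdist_tensor_disj_gt0 => k; rewrite ffunE.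
Qed.

Lemma output_size_ge_powR (R : realType) (n : nat) (pr : protocol R bool bool n) :
  (0 < n)%N -> is_collision_protocol (rho_disj R) pr n%:R^-1 ->
  n%:R `^ (1 / 4) <= (output_size (rho_disj R) pr)%:R :> R.
Proof.
move=> n0 prP; set s := output_size _ _.
pose tau := fdist_tensor (disj_marginal R) (nsamples pr).
pose a i := \sum_u tau u * hit_prob (alice (p := pr)) i u.
pose b i := \sum_v tau v * hit_prob (bob (p := pr)) i v.
have sa : \sum_i a i <= s%:R by apply: sum_hit_prob_le => u X /alice_card_le.
have sb : \sum_i b i <= s%:R by apply: sum_hit_prob_le => v Y /bob_card_le.
have a0 i : 0 <= a i.
  by apply: sumr_ge0 => u _; rewrite mulr_ge0 ?fdist_ge0 ?hit_prob_ge0.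
have b0 i : 0 <= b i.
  by apply: sumr_ge0 => u _; rewrite mulr_ge0 ?fdist_ge0 ?hit_prob_ge0.
pose t : R := n%:R `^ (1 / 4); rewrite -/t.
have t0 : 0 < t by rewrite powR_gt0 // ltr0n.
(* Writing n = t^4 turns n^(-3/4) into the integer power t^-3. *)
have t4 : t ^+ 4 = n%:R.
  by rewrite -powR_mulrn ?ltW // -powRrM mul1r mulVf ?pnatr_eq0 // powRr1.
have ab i : t ^- 3 <= (a i + b i) / 2.
  rewrite -(@ler_pXn2r _ 4) ?nnegrE ?divr_ge0 ?addr_ge0 ?invr_ge0 ?exprn_ge0 ?(ltW t0) //.
  have -> : (t ^- 3) ^+ 4 = n%:R^-1 ^+ 3 by rewrite -t4 !exprVn -!exprM.
  apply: (@le_trans _ _ (collision_prob (rho_disj R) pr i ^+ 3)).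
    have n0' : 0 <= n%:R^-1 :> R by rewrite invr_ge0.
    by rewrite lerXn2r ?nnegrE // (le_trans n0').
  rewrite collision_probE.
  apply: le_trans (disj_tensor_hypercontractive _ _) _ => [u|v|].
  - by rewrite hit_prob_ge0 hit_prob_le1.
  - by rewrite hit_prob_ge0 hit_prob_le1.
  rewrite -/tau -/(a i) -/(b i) -exprMn.
  rewrite (_ : ((a i + b i) / 2) ^+ 4 = (((a i + b i) / 2) ^+ 2) ^+ 2); last by rewrite -exprM.
  rewrite lerXn2r ?nnegrE ?(mulr_ge0 (a0 i) (b0 i)) ?sqr_ge0 // -subr_ge0.
  (* The inequality of arithmetic and geometric means. *)
  have -> : ((a i + b i) / 2) ^+ 2 - a i * b i = ((a i - b i) / 2) ^+ 2 by field.
  exact: sqr_ge0.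
have H : \sum_(i < n) t ^- 3 <= \sum_i (a i + b i) / 2 by apply: ler_sum.
(* The left side is n = t^4 copies of t^-3, hence t. *)
rewrite -mulr_suml big_split /= sumr_const card_ord -[leLHS]mulr_natr -t4 in H.
have tE : t ^- 3 * t ^+ 4 = t by field; rewrite gt_eqF.
rewrite tE in H.
by apply: le_trans H _; rewrite ler_pdivrMr // mulr_natr mulr2n lerD.
Qed.

Lemma bigOmega_collision_complexity (R : realType) :
  (fun n : nat => collision_complexity (rho_disj R) n)
    =Omega_\oo (fun n : nat => (n%:R : R) `^ (1 / 4)).
Proof.
rewrite eqOmegaE eqOmegaO; apply/eqO_exP; exists 1 => //.
near=> n.
have n0 : (0 < n)%N by near: n; exact: nbhs_infty_gt.
have c0 : 0 <= collision_complexity (rho_disj R) n.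
  by apply: le_collision_complexity.
rewrite [leRHS]mul1r (ger0_norm (powR_ge0 _ _)) (ger0_norm c0).
by apply: le_collision_complexity => pr; apply: output_size_ge_powR.
Unshelve. all: by end_near. Qed.

(** * The numerical exponents *)

Unset Implicit Arguments.
Set Strict Implicit.

Theorem propositionA5 (R : realType) :
  [/\ (fun n : nat => collision_complexity (rho_disj R) n)
        =O_\oo (fun n : nat => (n%:R : R) `^ log_base 6 2),
      (fun n : nat => collision_complexity (rho_disj R) n)
        =Omega_\oo (fun n : nat => (n%:R : R) `^ (1 / 4)),
      (fun n : nat => collision_complexity (rho_disj R) n)
        =O_\oo (fun n : nat => (n%:R : R) `^ (387 / 1000)) &
      (fun n : nat => collision_complexity (rho_disj R) n)
        =Omega_\oo (fun n : nat => (n%:R : R) `^ (25 / 100))].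
Proof.
have l2 : 0 < ln 2 :> R by rewrite ln_gt0 // ltr1n.
have l23 : ln 2 <= ln 3 :> R by rewrite ler_ln ?posrE // ler_nat.
have l3 := ln3_le R.
have l6 : ln 6 = ln 2 + ln 3 :> R by rewrite -lnM ?posrE // -natrM.
split.
- apply: bigO_collision_complexity; rewrite /log_base l6.
    by rewrite divr_ge0 ?ler_pdivrMr ?mul1r ?lerDl; lra.
  apply: three_powR_le2.
  have -> : 1 - ln 2 / (ln 2 + ln 3) = ln 3 / (ln 2 + ln 3) :> R by field; lra.
  (* For r = ln 3 / ln 2 the claim reads r^2 <= 1 + r; it follows from 1 <= r <= 8/5. *)
  by rewrite mulrAC ler_pdivrMr; nra.
- exact: bigOmega_collision_complexity.
- apply: bigO_collision_complexity; first by apply/andP; split; lra.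
  (* Here 1 - 0.387 = 0.613 <= 5/8 <= ln 2 / ln 3. *)
  by apply: three_powR_le2; lra.
- have -> : 25 / 100 = 1 / 4 :> R by field.
  exact: bigOmega_collision_complexity.
Qed.
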